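(* Let $\alpha_0,\alpha_1>0$, $u_0\in\mathbb{R}^{M\times N}$, and let $$\Phi(u,v)=\alpha_1\|\,|\nabla u-v|\,\|_1+\alpha_0\|\,|\mathcal{E}(v)|\,\|_1+\tfrac12\|u-u_0\|_2^2$$ be the primal functional of the TGV denoising problem, and let $(u^*,v^* )$ be a solution of $\min_{u,v}\Phi(u,v)$. Then for all $u,v$ and every dual variable $q$, the error of the primal energy can be estimated by $$\Phi(u,v)-\Phi(u^*,v^* )\le \alpha_1\|\,|\nabla u-v|\,\|_1+\alpha_0\|\,|\mathcal{E}(v)|\,\|_1+\tfrac12\|u-u_0\|_2^2+\tfrac12\|\nabla^*\mathcal{E}^*\tilde q\|_2^2-\langle\mathcal{E}^*\tilde q,\nabla u_0\rangle+\mathcal{I}_{\{\|\,|\cdot|\,\|_\infty\le\alpha_0\}}(\tilde q),$$ where $$\tilde q=\frac{q}{\max\left(1,\frac{\|\,|\mathcal{E}^*q|\,\|_\infty}{\alpha_1}\right)} .$$ Moreover, if $(u^n,v^n,q^n)$ is a sequence with $\|\,|q^n|\,\|_\infty\le\alpha_0$ for all $n$ that converges to a primal-dual solution, then the upper bound evaluated at $(u^n,v^n,q^n)$ converges to zero.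
   Context: Discrete setting: $u,u_0\in\mathbb{R}^{M\times N}$, $v\in\mathbb{R}^{M\times N\times 2}$, $q\in\mathbb{R}^{M\times N\times 4}$, all spaces with the Euclidean inner product $\langle\cdot,\cdot\rangle$ and norm $\|\cdot\|_2$. Forward differences with constant boundary extension: $(\partial_1u)_{i,j}=u_{i+1,j}-u_{i,j}$ and $(\partial_2u)_{i,j}=u_{i,j+1}-u_{i,j}$, with $u_{M+1,j}=u_{M,j}$ and $u_{i,N+1}=u_{i,N}$. The gradient is $\nabla u=(\partial_1u,\partial_2u)$. The symmetrized gradient is $\mathcal{E}(v)=\begin{pmatrix}\partial_1v_1&\frac12(\partial_1v_2+\partial_2v_1)\\ \frac12(\partial_1v_2+\partial_2v_1)&\partial_2v_2\end{pmatrix}$, viewed in $\mathbb{R}^{M\times N\times4}$. $\nabla^*$ and $\mathcal{E}^*$ are the adjoints. For $w\in\mathbb{R}^{M\times N\times K}$, $|w|_{i,j}=|w_{i,j}|$ is the Euclidean norm of $w_{i,j}\in\mathbb{R}^K$, $\|\,|w|\,\|_1=\sum_{i,j}|w_{i,j}|$, and $\|\,|w|\,\|_\infty=\max_{i,j}|w_{i,j}|$. $\mathcal{I}_C$ is the indicator function of $C$ ($0$ on $C$, $+\infty$ outside). The Fenchel–Rockafellar dual problem (after eliminating the dual variable $p=\mathcal{E}^*q$) is to maximize $-\tfrac12\|\nabla^*\mathcal{E}^*q\|_2^2+\langle\mathcal{E}^*q,\nabla u_0\rangle$ over $q$ subject to $\|\,|\mathcal{E}^*q|\,\|_\infty\le\alpha_1$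 and $\|\,|q|\,\|_\infty\le\alpha_0$. A primal-dual solution is a triple $(u^*,v^*,q^* )$ such that $(u^*,v^* )$ minimizes $\Phi$, $q^*$ solves the dual problem, and both optimal values coincide. *)

(* Defs.v *)
From HB Require Import structures.
From mathcomp Require Import all_boot all_order all_algebra.
From mathcomp Require Import all_classical all_reals all_analysis.
From mathcomp Require Import ring.

Set Implicit Arguments.
Unset Strict Implicit.
Unset Printing Implicit Defensive.

Import Order.TTheory GRing.Theory Num.Theory.
Import numFieldNormedType.Exports.

Local Open Scope classical_set_scope.
Local Open Scope ring_scope.

(* The space R^I for a finite index type I is the function space I -> R; its
   Euclidean structure is given explicitly by dotp and norm2. *)
Section Euclidean.
Context {R : realType}.
Implicit Types I J : finType.

Definition dotp I (x y : I -> R) : R := \sum_i x i * y i.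

Definition norm1 I (x : I -> R) : R := \sum_i `|x i|.

Definition norm2 I (x : I -> R) : R := Num.sqrt (dotp x x).

Definition normoo I (x : I -> R) : R := \big[Order.max/0]_i `|x i|.

Definition cvg2 I (x_ : nat -> I -> R) (x : I -> R) : Prop :=
  norm2 (x_ n - x) @[n --> \oo] --> (0 : R).

Definition unitv I (i : I) : I -> R := fun j => (j == i)%:R.

(* The i-th coordinate of the adjoint at y is <A e_i, y>; this is the adjoint
   only for linear A, see adjP. *)
Definition adj I J (A : (I -> R) -> (J -> R)) (y : J -> R) : I -> R :=
  fun i => dotp (A (unitv i)) y.

Lemma adjP I J (A : {linear (I -> R) -> (J -> R)}) (x : I -> R) (y : J -> R) :
  dotp (A x) y = dotp x (adj A y).
Proof.
have {1}-> : x = \sum_i x i *: unitv i.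
  apply/funext => j; rewrite fct_sumE (bigD1 j) //= big1 => [|i /negPf ij].
    by rewrite addr0 /unitv fctE eqxx /GRing.scale /= mulr1.
  by rewrite /unitv fctE eq_sym ij /GRing.scale /= mulr0.
rewrite linear_sum /dotp.
under eq_bigr do rewrite fct_sumE mulr_suml.
rewrite exchange_big /=; apply: eq_bigr => i _.
rewrite /adj /dotp mulr_sumr; apply: eq_bigr => j _.
by rewrite linearZ /= fctE /GRing.scale /= mulrA.
Qed.

Lemma lincombE I (a : R) (x y : I -> R) (i : I) :
  (a *: x + y) i = a * x i + y i.
Proof. by []. Qed.

(* The indicator function of convex analysis: 0 on C and +oo outside. *)
Definition convex_indic I (C : set (I -> R)) (x : I -> R) : \bar R :=
  if x \in C then 0%E else +oo%E.

End Euclidean.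

Definition grid (R : realType) (M N : nat) : Type := 'I_M * 'I_N -> R.

Definition vgrid (R : realType) (M N K : nat) : Type :=
  'I_M * 'I_N * 'I_K -> R.

(* i + 1, except that the last index is fixed: constant boundary extension. *)
Definition next_ord n (i : 'I_n) : 'I_n := insubd i i.+1.

Section Grid.
Context {R : realType} {M N : nat}.
Local Notation grid := (grid R M N).
Local Notation vgrid := (vgrid R M N).

Definition component K (w : vgrid K) (k : 'I_K) : grid := fun x => w (x, k).

Definition mag K (w : vgrid K) : grid :=
  fun x => norm2 (fun k : 'I_K => w (x, k)).

Definition partial1 (u : grid) : grid :=
  fun x => u (next_ord x.1, x.2) - u x.

Definition partial2 (u : grid) : grid :=
  fun x => u (x.1, next_ord x.2) - u x.

Definition grad (u : grid) : vgrid 2 :=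
  fun xk => tnth [tuple partial1 u; partial2 u] xk.2 xk.1.

(* The symmetric 2 x 2 matrix is stored row by row; both off-diagonal entries
   are kept, so they count twice in norms and inner products. *)
Definition symgrad (v : vgrid 2) : vgrid 4 :=
  let v1 := component v ord0 in
  let v2 := component v ord_max in
  let off : grid := fun x => 2^-1 * (partial1 v2 x + partial2 v1 x) in
  fun xk => tnth [tuple partial1 v1; off; off; partial2 v2] xk.2 xk.1.

End Grid.

Fact grad_is_linear (R : realType) (M N : nat) :
  linear (@grad R M N : ('I_M * 'I_N -> R) -> ('I_M * 'I_N * 'I_2 -> R)).
Proof.
move=> a u w; apply/funext => -[x [k hk]].
by case: k hk => [|[|//]] hk;
  rewrite lincombE /grad !(tnth_nth (fun=> 0)) /= /partial1 /partial2
    !lincombE; ring.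
Qed.

Fact symgrad_is_linear (R : realType) (M N : nat) :
  linear (@symgrad R M N :
    ('I_M * 'I_N * 'I_2 -> R) -> ('I_M * 'I_N * 'I_4 -> R)).
Proof.
move=> a u w; apply/funext => -[x [k hk]].
by case: k hk => [|[|[|[|//]]]] hk;
  rewrite lincombE /symgrad !(tnth_nth (fun=> 0)) /= /partial1 /partial2
    /component !lincombE; ring.
Qed.

HB.instance Definition _ (R : realType) (M N : nat) :=
  GRing.isLinear.Build R ('I_M * 'I_N -> R) ('I_M * 'I_N * 'I_2 -> R) _
    (@grad R M N) (@grad_is_linear R M N).

HB.instance Definition _ (R : realType) (M N : nat) :=
  GRing.isLinear.Build R ('I_M * 'I_N * 'I_2 -> R) ('I_M * 'I_N * 'I_4 -> R) _
    (@symgrad R M N) (@symgrad_is_linear R M N).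

Lemma grad_adjP (R : realType) (M N : nat) (u : grid R M N)
    (p : vgrid R M N 2) :
  dotp (grad u) p = dotp u (adj grad p).
Proof. exact: (adjP (@grad R M N)). Qed.

Lemma symgrad_adjP (R : realType) (M N : nat) (v : vgrid R M N 2)
    (q : vgrid R M N 4) :
  dotp (symgrad v) q = dotp v (adj symgrad q).
Proof. exact: (adjP (@symgrad R M N)). Qed.

Section TGV.
Context {R : realType} {M N : nat}.
Context (alpha0 alpha1 : R) (u0 : grid R M N).
Implicit Types (u : grid R M N) (v : vgrid R M N 2) (q : vgrid R M N 4).

Definition tgv_primal u v : R :=
  alpha1 * norm1 (mag (grad u - v)) + alpha0 * norm1 (mag (symgrad v))
  + 2^-1 * norm2 (u - u0) ^+ 2.

Definition tgv_dual q : R :=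
  - (2^-1 * norm2 (adj grad (adj symgrad q)) ^+ 2)
  + dotp (adj symgrad q) (grad u0).

Definition tgv_dual_feasible q : Prop :=
  normoo (mag (adj symgrad q)) <= alpha1 /\ normoo (mag q) <= alpha0.

Definition primal_solution u v : Prop :=
  forall u' v', tgv_primal u v <= tgv_primal u' v'.

Definition dual_solution q : Prop :=
  tgv_dual_feasible q /\
  forall q', tgv_dual_feasible q' -> tgv_dual q' <= tgv_dual q.

Definition primal_dual_solution u v q : Prop :=
  [/\ primal_solution u v, dual_solution q & tgv_primal u v = tgv_dual q].

Definition rescale q : vgrid R M N 4 :=
  (Num.max 1 (normoo (mag (adj symgrad q)) / alpha1))^-1 *: q.

Definition tgv_bound u v q : \bar R :=
  let qt := rescale q in
  ((alpha1 * norm1 (mag (grad u - v)) + alpha0 * norm1 (mag (symgrad v))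
    + 2^-1 * norm2 (u - u0) ^+ 2
    + 2^-1 * norm2 (adj grad (adj symgrad qt)) ^+ 2
    - dotp (adj symgrad qt) (grad u0))%:E
   + convex_indic [set q' : vgrid R M N 4 | normoo (mag q') <= alpha0]%R qt)%E.

End TGV.

(* Main.v *)
Require Import Defs.
From mathcomp Require Import all_boot all_order all_algebra.
From mathcomp Require Import all_classical all_reals all_analysis.
From mathcomp Require Import ring lra.

Set Implicit Arguments.
Unset Strict Implicit.
Unset Printing Implicit Defensive.

Import Order.TTheory GRing.Theory Num.Theory.
Import numFieldNormedType.Exports.

Local Open Scope classical_set_scope.
Local Open Scope ring_scope.

(** The bound is the duality gap at [(u, v)] and the rescaled dual variable
    [q~], plus the indicator of the one dual constraint that rescaling does not
    enforce ([tgv_boundE]).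

    The estimate is weak duality.  Moving [u0] and [v] through the adjoints
    writes [<E^* q, grad u0>] as
    [<E^* q, grad u - v> + <q, E v> + <grad^* E^* q, u0 - u>]
    ([dual_pairing_split]); for feasible [q] the first two pairings are at most
    the two norm terms of the primal energy ([dotp_mag_dual]), and Young's
    inequality bounds the third by the two quadratic terms.  Hence the dual
    value of a feasible [q] is below every primal value ([weak_duality]), hence
    below the minimum.  The factor in [q~] is exactly what makes
    [|E^* q~| <= alpha1] hold for every [q] ([rescale_feasible1]); if
    [|q~| <= alpha0] fails the bound is [+oo].

    For the convergence, rescaling only shrinks ([rescale_le]), so the indicator
    vanishes along the sequence.  Everything else is continuous in finitely many
    coordinates, and a dual feasible limit is fixed by rescaling ([rescale_id]):
    the bound converges to the gap at the limit, which is zero for a primal-dual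
    solution. *)

(** * Euclidean geometry of finite-dimensional function spaces *)

Section Euclidean.
Context {R : realType}.
Implicit Types I J : finType.

Lemma dotpC I (x y : I -> R) : dotp x y = dotp y x.
Proof. by apply: eq_bigr => i _; rewrite mulrC. Qed.

Lemma dotpDl I (x y z : I -> R) : dotp (x + y) z = dotp x z + dotp y z.
Proof. by rewrite /dotp -big_split; apply: eq_bigr => i _; exact: mulrDl. Qed.

Lemma dotpZr I (c : R) (x y : I -> R) : dotp x (c *: y) = c * dotp x y.
Proof. by rewrite /dotp mulr_sumr; apply: eq_bigr => i _; exact: mulrCA. Qed.

Lemma dotpp_ge0 I (x : I -> R) : 0 <= dotp x x.
Proof. by apply: sumr_ge0 => i _; rewrite -expr2 sqr_ge0. Qed.

Lemma sqr_norm2 I (x : I -> R) : norm2 x ^+ 2 = dotp x x.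
Proof. by rewrite sqr_sqrtr ?dotpp_ge0. Qed.

Lemma norm2_ge0 I (x : I -> R) : 0 <= norm2 x.
Proof. exact: sqrtr_ge0. Qed.

Lemma norm2Z I (c : R) (x : I -> R) : norm2 (c *: x) = `|c| * norm2 x.
Proof.
by rewrite /norm2 dotpZr dotpC dotpZr mulrA -expr2 sqrtrM ?sqr_ge0 ?sqrtr_sqr.
Qed.

Lemma coord_le_norm2 I (x : I -> R) i : `|x i| <= norm2 x.
Proof.
rewrite -sqrtr_sqr ler_wsqrtr // /dotp (bigD1 i) //= -expr2 lerDl.
by apply: sumr_ge0 => j _; rewrite -expr2 sqr_ge0.
Qed.

(** The common source of Young's inequality, at [s = t = 1], and of
    Cauchy-Schwarz, at [s = |y|] and [t = |x|]: the difference of the two sides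
    is the sum of the squares [(s x_i - t y_i)^2]. *)
Lemma dotp_le_weighted I (s t : R) (x y : I -> R) :
  2 * (s * t) * dotp x y <= s ^+ 2 * dotp x x + t ^+ 2 * dotp y y.
Proof.
rewrite /dotp !mulr_sumr -big_split /=; apply: ler_sum => i _.
rewrite -subr_ge0.
have -> : s ^+ 2 * (x i * x i) + t ^+ 2 * (y i * y i)
    - 2 * (s * t) * (x i * y i) = (s * x i - t * y i) ^+ 2 by ring.
exact: sqr_ge0.
Qed.

Lemma dotp_young I (x y : I -> R) :
  dotp x y <= 2^-1 * norm2 x ^+ 2 + 2^-1 * norm2 y ^+ 2.
Proof. by rewrite !sqr_norm2; have := dotp_le_weighted 1 1 x y; lra. Qed.

Lemma dotp_norm2_eq0 I (x y : I -> R) : norm2 x = 0 -> dotp x y = 0.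
Proof.
move=> x0; apply: big1 => i _; apply/eqP.
by rewrite mulf_eq0 -normr_le0 -x0 coord_le_norm2.
Qed.

Lemma cauchy_schwarz I (x y : I -> R) : dotp x y <= norm2 x * norm2 y.
Proof.
have [x0|x0] := eqVneq (norm2 x) 0; first by rewrite dotp_norm2_eq0 // x0 mul0r.
have [y0|y0] := eqVneq (norm2 y) 0.
  by rewrite dotpC dotp_norm2_eq0 // y0 mulr0.
have xy_gt0 : 0 < norm2 x * norm2 y.
  by rewrite mulr_gt0 // lt0r ?x0 ?y0 norm2_ge0.
rewrite -(ler_pM2l xy_gt0).
by have := dotp_le_weighted (norm2 y) (norm2 x) x y; rewrite -!sqr_norm2; nra.
Qed.

Lemma coord_le_normoo I (x : I -> R) i : `|x i| <= normoo x.
Proof. exact: (le_bigmax 0 (fun i => `|x i|)). Qed.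

Lemma normoo_ge0 I (x : I -> R) : 0 <= normoo x.
Proof. exact: bigmax_ge_id. Qed.

Lemma normooZ I (c : R) (x : I -> R) : normoo (c *: x) = `|c| * normoo x.
Proof.
rewrite /normoo (big_morph (fun a => `|c| * a) (id1 := 0) (op1 := Order.max)).
- by apply: eq_bigr => i _; rewrite -normrM.
- by move=> a b; rewrite maxr_pMr.
- by rewrite mulr0.
Qed.

Lemma adjZ I J (A : (I -> R) -> (J -> R)) (c : R) (y : J -> R) :
  adj A (c *: y) = c *: adj A y.
Proof. by apply/funext => i; rewrite /adj dotpZr. Qed.

(** Each coordinate of a linear map is an inner product with a fixed vector, so
    its continuity is an instance of that of [dotp]. *)
Lemma linear_coord I J (A : {linear (I -> R) -> (J -> R)}) x j :
  A x j = dotp x (adj A (unitv j)).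
Proof.
rewrite -adjP /dotp (bigD1 j) //= big1 => [|i /negPf ij].
  by rewrite /unitv eqxx mulr1 addr0.
by rewrite /unitv ij mulr0.
Qed.

End Euclidean.

(** * Duality of the mixed norms *)

Section Mag.
Context {R : realType} {M N K : nat}.
Implicit Types p w : vgrid R M N K.

Lemma mag_ge0 w x : 0 <= mag w x.
Proof. exact: norm2_ge0. Qed.

Lemma magZ (c : R) w : mag (c *: w) = `|c| *: mag w.
Proof. by apply/funext => x; exact: (norm2Z c (fun k => w (x, k))). Qed.

(** Hoelder's inequality for the pair of mixed norms: Cauchy-Schwarz within each
    pixel, then the bound [a] on the magnitudes of [p], pixel by pixel. *)
Lemma dotp_mag_dual p w (a : R) :
  normoo (mag p) <= a -> dotp p w <= a * norm1 (mag w).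
Proof.
move=> pa; rewrite /norm1 mulr_sumr.
have -> : dotp p w
    = \sum_x dotp (fun k : 'I_K => p (x, k)) (fun k => w (x, k)).
  by rewrite pair_big /=; apply: eq_bigr => -[].
apply: ler_sum => x _; apply: (le_trans (cauchy_schwarz _ _)).
rewrite (ger0_norm (mag_ge0 w x)) ler_wpM2r ?norm2_ge0 //.
by apply: le_trans pa; rewrite -[leLHS]ger0_norm ?norm2_ge0 ?coord_le_normoo.
Qed.

End Mag.

(** * Weak duality and the rescaled dual variable *)

Section WeakDuality.
Context {R : realType} {M N : nat} (alpha0 alpha1 : R) (u0 : grid R M N).
Implicit Types (u : grid R M N) (v : vgrid R M N 2) (q : vgrid R M N 4).

Lemma dual_pairing_split u v q :
  dotp (adj symgrad q) (grad u0) =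
    dotp (adj symgrad q) (grad u - v) + dotp q (symgrad v)
    + dotp (adj grad (adj symgrad q)) (u0 - u).
Proof.
rewrite (dotpC q) (dotpC _ (u0 - u)) symgrad_adjP -grad_adjP.
rewrite (dotpC _ (grad u0)) (dotpC _ (grad u - v)) -!dotpDl.
by rewrite subrK (linearB (@grad R M N)) addrC subrK.
Qed.

Lemma weak_duality u v q :
  tgv_dual_feasible alpha0 alpha1 q ->
  tgv_dual u0 q <= tgv_primal alpha0 alpha1 u0 u v.
Proof.
move=> [pa1 qa0]; rewrite /tgv_dual /tgv_primal (dual_pairing_split u v).
have := dotp_mag_dual (grad u - v) pa1; have := dotp_mag_dual (symgrad v) qa0.
have := dotp_young (adj grad (adj symgrad q)) (u0 - u).
have -> : norm2 (u0 - u) = norm2 (u - u0).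
  by rewrite -opprB -scaleN1r norm2Z normrN1 mul1r.
lra.
Qed.

Lemma rescale_factor_gt0 q :
  0 < Num.max 1 (normoo (mag (adj symgrad q)) / alpha1).
Proof. by rewrite lt_max ltr01. Qed.

Lemma rescale_feasible1 q : 0 < alpha1 ->
  normoo (mag (adj symgrad (rescale alpha1 q))) <= alpha1.
Proof.
move=> a1; have c0 := rescale_factor_gt0 q.
rewrite /rescale adjZ magZ normooZ normr_id gtr0_norm ?invr_gt0 //.
by rewrite ler_pdivrMl // -ler_pdivrMr // le_max lexx orbT.
Qed.

(** The denominator is at least 1, so the constraint [|q| <= alpha0] survives
    rescaling. *)
Lemma rescale_le q :
  normoo (mag (rescale alpha1 q)) <= normoo (mag q).
Proof.
have c0 := rescale_factor_gt0 q.
rewrite /rescale magZ normooZ normr_id gtr0_norm ?invr_gt0 //.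
rewrite ler_pdivrMl // ler_peMl ?normoo_ge0 //.
by rewrite le_max lexx.
Qed.

Lemma rescale_id q : 0 < alpha1 ->
  normoo (mag (adj symgrad q)) <= alpha1 -> rescale alpha1 q = q.
Proof.
move=> a1 qa1; rewrite /rescale max_l ?invr1 ?scale1r //.
by rewrite ler_pdivrMr // mul1r.
Qed.

Lemma tgv_boundE u v q : tgv_bound alpha0 alpha1 u0 u v q =
  ((tgv_primal alpha0 alpha1 u0 u v - tgv_dual u0 (rescale alpha1 q))%:E
   + convex_indic [set q' : vgrid R M N 4 | (normoo (mag q') <= alpha0)%R]
       (rescale alpha1 q))%E.
Proof. by rewrite /tgv_bound /tgv_primal /tgv_dual opprD opprK addrA. Qed.

End WeakDuality.

(** * Continuity of the energies under coordinatewise convergence *)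

Section Continuity.
Context {R : realType} {T : Type} {F : set_system T} {FF : Filter F}.
Implicit Types I J : finType.

Lemma cvg_dotp I (x_ y_ : T -> I -> R) (x y : I -> R) :
  (forall i, x_ t i @[t --> F] --> x i) ->
  (forall i, y_ t i @[t --> F] --> y i) ->
  dotp (x_ t) (y_ t) @[t --> F] --> dotp x y.
Proof.
move=> xx yy; apply: cvg_big => [|i _]; first exact: add_continuous.
exact: cvgM (xx i) (yy i).
Qed.

Lemma cvg_norm1 I (x_ : T -> I -> R) (x : I -> R) :
  (forall i, x_ t i @[t --> F] --> x i) ->
  norm1 (x_ t) @[t --> F] --> norm1 x.
Proof.
move=> xx; apply: cvg_big => [|i _]; first exact: add_continuous.
exact: cvg_norm (xx i).
Qed.

Lemma cvg_norm2 I (x_ : T -> I -> R) (x : I -> R) :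
  (forall i, x_ t i @[t --> F] --> x i) ->
  norm2 (x_ t) @[t --> F] --> norm2 x.
Proof.
move=> xx; apply: (continuous_cvg _ (@sqrt_continuous R (dotp x x))).
exact: cvg_dotp.
Qed.

Lemma cvg_normoo I (x_ : T -> I -> R) (x : I -> R) :
  (forall i, x_ t i @[t --> F] --> x i) ->
  normoo (x_ t) @[t --> F] --> normoo x.
Proof.
move=> xx; apply: cvg_big => [|i _]; first exact: max_continuous.
exact: cvg_norm (xx i).
Qed.

Lemma cvg_linear I J (A : {linear (I -> R) -> (J -> R)})
    (x_ : T -> I -> R) (x : I -> R) (j : J) :
  (forall i, x_ t i @[t --> F] --> x i) ->
  A (x_ t) j @[t --> F] --> A x j.
Proof.
move=> xx; rewrite linear_coord; under eq_fun do rewrite linear_coord.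
by apply: cvg_dotp => // i; exact: cvg_cst.
Qed.

Lemma cvg_adj I J (A : (I -> R) -> (J -> R))
    (y_ : T -> J -> R) (y : J -> R) (i : I) :
  (forall j, y_ t j @[t --> F] --> y j) ->
  adj A (y_ t) i @[t --> F] --> adj A y i.
Proof. by move=> yy; apply: cvg_dotp => // j; exact: cvg_cst. Qed.

Lemma cvg_mag M N K (w_ : T -> vgrid R M N K) (w : vgrid R M N K) x :
  (forall i, w_ t i @[t --> F] --> w i) ->
  mag (w_ t) x @[t --> F] --> mag w x.
Proof. by move=> ww; apply: cvg_norm2 => k; exact: ww. Qed.

Section TGV.
Context {M N : nat} (alpha0 alpha1 : R) (u0 : grid R M N).
Context (u_ : T -> grid R M N) (u : grid R M N).
Context (v_ : T -> vgrid R M N 2) (v : vgrid R M N 2).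
Context (q_ : T -> vgrid R M N 4) (q : vgrid R M N 4).

Lemma cvg_tgv_primal :
  (forall i, u_ t i @[t --> F] --> u i) ->
  (forall i, v_ t i @[t --> F] --> v i) ->
  tgv_primal alpha0 alpha1 u0 (u_ t) (v_ t) @[t --> F]
    --> tgv_primal alpha0 alpha1 u0 u v.
Proof.
move=> uu vv; apply: cvgD; first apply: cvgD.
- apply: cvgM; first exact: cvg_cst.
  apply: cvg_norm1 => x; apply: cvg_mag => i; apply: cvgB; last exact: vv.
  exact: (cvg_linear (A := @grad R M N)).
- apply: cvgM; first exact: cvg_cst.
  apply: cvg_norm1 => x; apply: cvg_mag => i.
  exact: (cvg_linear (A := @symgrad R M N)).
- apply: cvgM; first exact: cvg_cst.
  rewrite !expr2; under eq_fun do rewrite expr2.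
  have nn : norm2 (u_ t - u0) @[t --> F] --> norm2 (u - u0).
    by apply: cvg_norm2 => i; apply: cvgB; [exact: uu|exact: cvg_cst].
  exact: (cvgM nn nn).
Qed.

Lemma cvg_tgv_dual :
  (forall i, q_ t i @[t --> F] --> q i) ->
  tgv_dual u0 (q_ t) @[t --> F] --> tgv_dual u0 q.
Proof.
move=> qq.
have pp i : adj symgrad (q_ t) i @[t --> F] --> adj symgrad q i.
  exact: cvg_adj.
apply: cvgD.
- rewrite /tgv_dual; apply: cvgN; apply: cvgM; first exact: cvg_cst.
  rewrite !sqr_norm2; under eq_fun do rewrite sqr_norm2.
  by apply: cvg_dotp => i; exact: cvg_adj.
- by apply: cvg_dotp => // i; exact: cvg_cst.
Qed.

Lemma cvg_rescale i :
  (forall i, q_ t i @[t --> F] --> q i) ->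
  rescale alpha1 (q_ t) i @[t --> F] --> rescale alpha1 q i.
Proof.
move=> qq; apply: cvgM; last exact: qq.
apply: cvgV; first by rewrite gt_eqF ?rescale_factor_gt0.
apply: (@continuous2_cvg _ R R R F _ (fun=> 1) _ Num.max).
- exact: (@max_continuous _ R (1, normoo (mag (adj symgrad q)) / alpha1)).
- exact: cvg_cst.
- apply: cvgM; last exact: cvg_cst.
  by apply: cvg_normoo => x; apply: cvg_mag => j; exact: cvg_adj.
Qed.

End TGV.
End Continuity.

Lemma cvg2_coord (R : realType) (I : finType) (x_ : nat -> I -> R)
    (x : I -> R) :
  cvg2 x_ x -> forall i, x_ n i @[n --> \oo] --> x i.
Proof.
move=> xx i; apply/subr_cvg0; apply: norm_cvg0.
apply: (squeeze_cvgr _ (cvg_cst 0) xx); apply: nearW => n.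
by rewrite normr_ge0 (coord_le_norm2 (x_ n - x) i).
Qed.

Theorem corollary6 (R : realType) (M N : nat) (alpha0 alpha1 : R)
    (u0 : grid R M N) (ustar : grid R M N) (vstar : vgrid R M N 2) :
  0 < alpha0 -> 0 < alpha1 ->
  primal_solution alpha0 alpha1 u0 ustar vstar ->
  (forall (u : grid R M N) (v : vgrid R M N 2) (q : vgrid R M N 4),
     ((tgv_primal alpha0 alpha1 u0 u v
       - tgv_primal alpha0 alpha1 u0 ustar vstar)%:E
      <= tgv_bound alpha0 alpha1 u0 u v q)%E) /\
  (forall (u_ : nat -> grid R M N) (v_ : nat -> vgrid R M N 2)
          (q_ : nat -> vgrid R M N 4)
          (uhat : grid R M N) (vhat : vgrid R M N 2) (qhat : vgrid R M N 4),
     (forall n, normoo (mag (q_ n)) <= alpha0) ->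
     primal_dual_solution alpha0 alpha1 u0 uhat vhat qhat ->
     cvg2 u_ uhat -> cvg2 v_ vhat -> cvg2 q_ qhat ->
     tgv_bound alpha0 alpha1 u0 (u_ n) (v_ n) (q_ n) @[n --> \oo] --> 0%E).
Proof.
move=> a0 a1 opt; split.
  move=> u v q; rewrite tgv_boundE /convex_indic; case: ifPn => [|_].
    rewrite inE /= => qa0; rewrite adde0 lee_fin lerB // weak_duality //.
    by split=> //; exact: rescale_feasible1.
  by rewrite addey ?leey.
move=> u_ v_ q_ u v q qa0 [_ [[qa1 _] _] gap0] /cvg2_coord uu /cvg2_coord vv
  /cvg2_coord qq.
(* The limit is feasible, so zero is its gap also after rescaling. *)
have {gap0} -> : 0%E = (tgv_primal alpha0 alpha1 u0 u v
    - tgv_dual u0 (rescale alpha1 q))%:E.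
  by rewrite rescale_id // gap0 subrr.
under eq_fun => n.
  rewrite tgv_boundE /convex_indic mem_set ?adde0 /=; last first.
    exact: le_trans (rescale_le _ _) (qa0 n).
  over.
apply: cvg_EFin; first exact: nearW.
apply: cvgB; first exact: cvg_tgv_primal.
by apply: cvg_tgv_dual => i; exact: cvg_rescale.
Qed.
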